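(* Let $(S,\Sigma_S,\nu)$ and $(T,\Sigma_T,\eta)$ be standard measure spaces, let $b\colon T\to[0,\nu(S)]$ and $c\colon S\to[0,\eta(T)]$ be Borel measurable, and let $E\subseteq S\times T$ be measurable with respect to $\Sigma_S\otimes\Sigma_T$. With $\mu=\nu\otimes\eta$, the supremum $$m_E(b,c)=\sup\{\mu(F)\mid F\subseteq E\text{ measurable},\ \nu(F_t)\le b(t)\text{ for }\eta\text{-a.e. }t\in T,\ \eta(F^s)\le c(s)\text{ for }\nu\text{-a.e. }s\in S\}$$ is attained.
   Context: A standard measure space is a standard Borel space equipped with a finite atomless measure. For $X\subseteq S\times T$, the sections are $X_t=\{s\in S\mid(s,t)\in X\}$ for $t\in T$ and $X^s=\{t\in T\mid(s,t)\in X\}$ for $s\in S$. $\nu\otimes\eta$ is the product measure on $\Sigma_S\otimes\Sigma_T$. *)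

(* Defs.v *)
From mathcomp Require Import all_boot all_order all_algebra.
From mathcomp Require Import all_classical all_reals all_analysis.

Set Implicit Arguments.
Unset Strict Implicit.
Unset Printing Implicit Defensive.

Import Order.TTheory GRing.Theory Num.Theory.

Local Open Scope classical_set_scope.
Local Open Scope ring_scope.

Section standard_measure_space.
Context {R : realType}.

(* The library's [completeType] bundles a distinguished point and is not
   joined with [metricType]; [complete_metric] is its axiom, stated for an
   unpointed metric space. *)
Definition complete_metric (X : metricType R) : Prop :=
  forall F : set_system X, ProperFilter F -> cauchy F -> exists x : X, F --> x.

Definition separable (X : topologicalType) : Prop :=
  exists2 D : set X, countable D & dense D.

(* The metric on [X] only serves to generate a Polish topology: nothing
   relates it to [T] beyond the Borel isomorphism [f], with inverse [g]. *)
Definition standard_borel d (T : measurableType d) : Prop :=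
  exists X : metricType R,
    [/\ complete_metric X, separable X &
      exists (f : T -> X) (g : X -> T),
        [/\ cancel f g, cancel g f,
            forall B : set X, <<s @open X >> B -> measurable (f @^-1` B) &
            forall A : set T, measurable A -> <<s @open X >> (g @^-1` A)]].

Definition atomless d (T : measurableType d)
    (mu : set T -> \bar R) : Prop :=
  forall A : set T, measurable A -> (0 < mu A)%E ->
    exists B : set T, [/\ measurable B, B `<=` A & (0 < mu B < mu A)%E].

Definition standard_measure_space d (T : measurableType d)
    (mu : {finite_measure set T -> \bar R}) : Prop :=
  standard_borel T /\ atomless mu.

End standard_measure_space.

Section constrained_subsets.
Context {R : realType} d1 d2 (S : measurableType d1) (T : measurableType d2).
Variables (nu : {finite_measure set S -> \bar R})
          (eta : {finite_measure set T -> \bar R}).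
Variables (E : set (S * T)) (b : T -> R) (c : S -> R).

(* [ysection F t] is the section F_t, a subset of S, and [xsection F s] is
   F^s, a subset of T. *)
Definition feasible : set (set (S * T)) :=
  [set F | [/\ measurable F, F `<=` E,
               {ae eta, forall t, (nu (ysection F t) <= (b t)%:E)%E} &
               {ae nu, forall s, (eta (xsection F s) <= (c s)%:E)%E}]].

Definition max_measure : \bar R :=
  ereal_sup [set (nu \x eta)%E F | F in feasible].

End constrained_subsets.

(* Main.v *)
From HB Require Import structures.
Require Import Defs.
From mathcomp Require Import all_boot all_order all_algebra.
From mathcomp Require Import all_classical all_reals all_analysis.
From mathcomp Require Import measurable_realfun ring lra.

(** The supremum is first attained by a fractional solution, a function f with
    values in [0, 1], zero off E, whose section integrals obey the bounds b and
    c; an extremal fractional solution is then shown to be an indicator.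

    Fractional solutions form a convex set, closed for almost everywhere
    convergence, so a linear functional attains its maximum on it
    ([integral_maximizer]): near-maximizers whose square integral is nearly
    least form a Cauchy sequence, by the parallelogram law, and this replaces
    weak compactness.  This is used twice.  Maximizing the integral of f gives
    a nonempty convex set of optimal fractional solutions; among those, f is
    chosen to maximize the integral of f(s,t) p(s) q(t), where p and q are
    injective bounded measurable real functions on S and T, which exist because
    the spaces are standard Borel ([standard_borel_code],
    [optimal_fractional_maximizer]).

    Such an f is almost everywhere 0 or 1.  Put a = f (1 - f) and consider
      h(s,t) = int int a(s,t) a(s',t) a(s,t') a(s',t')
                 (p(s) - p(s')) (q(t) - q(t')) ds' dt',
    the superposition of all signed rectangles with corners (s,t), (s',t),
    (s,t'), (s',t'), weighted by a at the corners.  The integrand changes sign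
    when s and s' are exchanged, and when t and t' are, so all section
    integrals of h vanish; as h is a times a bounded function, f + delta h is
    an optimal fractional solution for small delta > 0.  On the other hand,
    symmetrizing in (s,s') and in (t,t'),
      int h p q = 1/4 int a a a a (p(s) - p(s'))^2 (q(t) - q(t'))^2,
    which is positive unless a = 0 almost everywhere: p and q are injective and
    points are null because the measures are atomless, so the squared factors
    vanish on a null set only ([marginal_free_perturbation],
    [extremal_fractional_01]).  By the choice of f, a vanishes almost
    everywhere, and F = [set z | f z = 1] has the measure int f and sections
    no larger than those of f ([rounding]). *)

Import Order.TTheory GRing.Theory Num.Theory.
Import numFieldNormedType.Exports.

Local Open Scope classical_set_scope.
Local Open Scope ring_scope.

Set Implicit Arguments.
Unset Strict Implicit.
Unset Printing Implicit Defensive.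

(** * Integration of bounded measurable functions against a finite measure *)

Definition bounded_mfun d (X : measurableType d) (R : realType)
    (F : X -> R) : Prop :=
  measurable_fun [set: X] F /\ exists M, forall x, `|F x| <= M.

Section bounded_mfun_closure.
Context d (X : measurableType d) (R : realType).
Implicit Types F G : X -> R.

Lemma bounded_mfun_cst (r : R) : bounded_mfun (fun _ : X => r).
Proof. by split; [exact: measurable_cst|exists `|r|]. Qed.

Lemma bounded_mfunD F G : bounded_mfun F -> bounded_mfun G ->
  bounded_mfun (fun x => F x + G x).
Proof.
move=> [mF [M FM]] [mG [N GN]]; split; first exact: measurable_funD.
by exists (M + N) => x; rewrite (le_trans (ler_normD _ _))// lerD.
Qed.

Lemma bounded_mfunM F G : bounded_mfun F -> bounded_mfun G ->
  bounded_mfun (fun x => F x * G x).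
Proof.
move=> [mF [M FM]] [mG [N GN]]; split; first exact: measurable_funM.
by exists (M * N) => x; rewrite normrM ler_pM.
Qed.

Lemma bounded_mfunN F : bounded_mfun F -> bounded_mfun (fun x => - F x).
Proof.
move=> [mF [M FM]]; split; first exact: measurableT_comp.
by exists M => x; rewrite normrN.
Qed.

Lemma bounded_mfunB F G : bounded_mfun F -> bounded_mfun G ->
  bounded_mfun (fun x => F x - G x).
Proof. by move=> bF bG; apply: bounded_mfunD => //; exact: bounded_mfunN. Qed.

Lemma bounded_mfun_norm F : bounded_mfun F -> bounded_mfun (fun x => `|F x|).
Proof.
move=> [mF [M FM]]; split; first exact: measurableT_comp.
by exists M => x; rewrite normr_id.
Qed.

Lemma bounded_mfun_indic (A : set X) : measurable A ->
  bounded_mfun (\1_A : X -> R).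
Proof.
move=> mA; split; first exact: measurable_indic.
by exists 1 => x; rewrite indicE; case: (_ \in _); rewrite ?normr1 ?normr0.
Qed.

Lemma bounded_mfun01 F : measurable_fun [set: X] F ->
  (forall x, 0 <= F x <= 1) -> bounded_mfun F.
Proof.
by move=> mF F01; split=> //; exists 1 => x; case/andP: (F01 x) => ? ?;
  rewrite ger0_norm.
Qed.

Lemma bounded_mfun_comp d' (Y : measurableType d') (k : Y -> X) F :
  measurable_fun [set: Y] k -> bounded_mfun F ->
  bounded_mfun (fun y => F (k y)).
Proof.
move=> mk [mF [M FM]]; split; first exact: (measurableT_comp mF mk).
by exists M => y.
Qed.

End bounded_mfun_closure.

Section bounded_mfun_integral.
Context d (X : measurableType d) (R : realType).
Variable m : {finite_measure set X -> \bar R}.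
Implicit Types F G : X -> R.

Lemma bounded_mfun_integrable F : bounded_mfun F ->
  m.-integrable [set: X] (EFin \o F).
Proof.
move=> [mF [M FM]]; apply: measurable_bounded_integrable => //.
  by rewrite -ge0_fin_numE// fin_num_measure.
by exists M; split; [exact: num_real|move=> N MN x _ /=;
  rewrite (le_trans (FM x))// ltW].
Qed.

Lemma EFin_bounded_integral F : bounded_mfun F ->
  (\int[m]_x F x)%:E = (\int[m]_x (F x)%:E)%E.
Proof.
move=> /bounded_mfun_integrable iF; rewrite /Rintegral fineK//.
exact: integrable_fin_num.
Qed.

Lemma bounded_integralD F G : bounded_mfun F -> bounded_mfun G ->
  \int[m]_x (F x + G x) = \int[m]_x F x + \int[m]_x G x.
Proof. by move=> *; apply: RintegralD => //;
  exact: bounded_mfun_integrable. Qed.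

Lemma bounded_integralB F G : bounded_mfun F -> bounded_mfun G ->
  \int[m]_x (F x - G x) = \int[m]_x F x - \int[m]_x G x.
Proof. by move=> *; apply: RintegralB => //;
  exact: bounded_mfun_integrable. Qed.

Lemma bounded_integralZ (r : R) F : bounded_mfun F ->
  \int[m]_x (r * F x) = r * \int[m]_x F x.
Proof. by move=> *; apply: RintegralZl => //;
  exact: bounded_mfun_integrable. Qed.

Lemma bounded_le_integral F G : bounded_mfun F -> bounded_mfun G ->
  (forall x, F x <= G x) -> \int[m]_x F x <= \int[m]_x G x.
Proof. by move=> *; apply: le_Rintegral => //;
  exact: bounded_mfun_integrable. Qed.

Lemma norm_integral_le F (M : R) : bounded_mfun F -> (forall x, `|F x| <= M) ->
  `|\int[m]_x F x| <= M * fine (m setT).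
Proof.
move=> bF FM; apply: le_trans (le_normr_Rintegral _ _) _ => //.
  exact: bounded_mfun_integrable.
rewrite -Rintegral_cst//; apply: bounded_le_integral => //;
  last exact: bounded_mfun_cst.
exact: bounded_mfun_norm.
Qed.

Lemma ae_eq_Rintegral F G : bounded_mfun F -> bounded_mfun G ->
  {ae m, forall x, F x = G x} -> \int[m]_x F x = \int[m]_x G x.
Proof.
move=> [mF _] [mG _] FG; congr fine; apply: ae_eq_integral => //.
- exact/measurable_EFinP.
- exact/measurable_EFinP.
- by apply: filterS FG => x + _ => ->.
Qed.

Lemma integral0_ae F : bounded_mfun F -> (forall x, 0 <= F x) ->
  \int[m]_x F x = 0 -> {ae m, forall x, F x = 0}.
Proof.
move=> bF F0 int0; have := congr1 (@EFin R) int0.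
rewrite EFin_bounded_integral// => intF.
have [+ _] := @ae_eq_integral_abs _ _ _ m setT measurableT (EFin \o F)
  ((measurable_EFinP _ _).2 bF.1).
under eq_integral do rewrite gee0_abs ?lee_fin//.
move=> /(_ intF); apply: filterS => x /(_ I); exact: (congr1 fine).
Qed.

Lemma cvg_integral (u : nat -> X -> R) F (M : R) :
  (forall n, measurable_fun [set: X] (u n)) -> (forall n x, `|u n x| <= M) ->
  (forall x, u n x @[n --> \oo] --> F x) ->
  bounded_mfun F /\ (\int[m]_x u n x @[n --> \oo] --> \int[m]_x F x).
Proof.
move=> mu uM uF.
have mF : measurable_fun [set: X] F by apply: (measurable_fun_cvg mu) => x _;
  exact: uF.
have bF : bounded_mfun F.
  split=> //; exists M => x.
  have /cvg_norm/= h : u n x @[n --> \oo] --> F x by exact: uF.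
  rewrite -(cvg_lim _ h)//; apply: limr_le; first by apply/cvg_ex;
    exists `|F x|.
  by apply: nearW => n; exact: uM.
have bu n : bounded_mfun (u n) by split=> //; exists M.
split=> //.
have := @dominated_convergence _ X R m setT measurableT
  (fun n => EFin \o u n) (EFin \o F) (cst M%:E).
move=> [].
- by move=> n; exact/measurable_EFinP.
- exact/measurable_EFinP.
- by apply: aeW => x _; apply: cvg_EFin; [exact: nearW|exact: uF].
- exact: (bounded_mfun_integrable (bounded_mfun_cst _ M)).
- by apply: aeW => x n _ /=; rewrite lee_fin.
move=> _ _ h; rewrite -(EFin_bounded_integral bF) in h.
exact: (fine_cvg h).
Qed.

End bounded_mfun_integral.

Section product_finite_measure.
Context d1 d2 (X : measurableType d1) (Y : measurableType d2) (R : realType).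
Variables (m1 : {finite_measure set X -> \bar R})
          (m2 : {finite_measure set Y -> \bar R}).

(** The product under a name of its own, to which the structure of a finite
    measure is attached. *)
Definition prod_measure : set (X * Y)%type -> \bar R := (m1 \x m2)%E.

HB.instance Definition _ := Measure.on prod_measure.

Let prod_fin_num : fin_num_fun prod_measure.
Proof.
move=> A mA; rewrite ge0_fin_numE//.
apply: (@le_lt_trans _ _ (prod_measure setT)); first by apply: le_measure;
  rewrite ?inE.
rewrite -setXTT [prod_measure _]product_measure1E//.
by rewrite ltey_eq fin_numM// fin_num_measure.
Qed.

HB.instance Definition _ :=
  Measure_isFinite.Build _ _ _ prod_measure prod_fin_num.

End product_finite_measure.

Section bounded_fubini.
Context d1 d2 (X : measurableType d1) (Y : measurableType d2) (R : realType).
Variables (m1 : {finite_measure set X -> \bar R})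
          (m2 : {finite_measure set Y -> \bar R}).
Implicit Type F : X * Y -> R.

Lemma bounded_mfun_xslice F x : bounded_mfun F ->
  bounded_mfun (fun y => F (x, y)).
Proof. by apply: bounded_mfun_comp; exact: measurable_fun_pair. Qed.

Lemma bounded_mfun_yslice F y : bounded_mfun F ->
  bounded_mfun (fun x => F (x, y)).
Proof. by apply: bounded_mfun_comp; exact: measurable_fun_pair. Qed.

Lemma bounded_mfun_int2 F : bounded_mfun F ->
  bounded_mfun (fun x => \int[m2]_y F (x, y)).
Proof.
move=> bF; have [_ [M FM]] := bF; split.
  apply/measurable_EFinP.
  rewrite [X in measurable_fun _ X](_ : _ = fubini_F m2 (EFin \o F)).
    (* the slices ignore the measure on X: the zero measure will do *)
    apply: (@measurable_fubini_F _ _ _ _ _ mzero m2).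
    apply: measurable_bounded_integrable => //; last 2 first.
    - by case: bF.
    - by exists M; split=> [|N MN z _];
      [exact: num_real|exact: le_trans (FM z) (ltW MN)].
    by rewrite -setXTT [ltLHS]product_measure1E// ?/mzero ?mul0e ?mule0.
  apply/funext => x /=; rewrite EFin_bounded_integral//.
  exact: bounded_mfun_xslice.
by exists (M * fine (m2 setT)) => x; apply: norm_integral_le => //;
  exact: bounded_mfun_xslice.
Qed.

Lemma bounded_mfun_int1 F : bounded_mfun F ->
  bounded_mfun (fun y => \int[m1]_x F (x, y)).
Proof.
move=> bF; have [_ [M FM]] := bF; split.
  apply/measurable_EFinP.
  rewrite [X in measurable_fun _ X](_ : _ = fubini_G m1 (EFin \o F)).
    apply: (@measurable_fubini_G _ _ _ _ _ m1 mzero).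
    apply: measurable_bounded_integrable => //; last 2 first.
    - by case: bF.
    - by exists M; split=> [|N MN z _];
      [exact: num_real|exact: le_trans (FM z) (ltW MN)].
    by rewrite -setXTT [ltLHS]product_measure1E// ?/mzero ?mul0e ?mule0.
  apply/funext => x /=; rewrite EFin_bounded_integral//.
  exact: bounded_mfun_yslice.
by exists (M * fine (m1 setT)) => x; apply: norm_integral_le => //;
  exact: bounded_mfun_yslice.
Qed.

Lemma integral_prod12 F : bounded_mfun F ->
  \int[prod_measure m1 m2]_z F z = \int[m1]_x \int[m2]_y F (x, y).
Proof.
move=> bF; rewrite /Rintegral.
rewrite -(@integral12_prod_meas1 _ _ _ _ _ m1 m2 _ (bounded_mfun_integrable
  (prod_measure m1 m2) bF)).
congr fine; apply: eq_integral => x _ /=; rewrite /fubini_F/=.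
by rewrite -EFin_bounded_integral//; exact: bounded_mfun_xslice.
Qed.

Lemma integral_prod21 F : bounded_mfun F ->
  \int[prod_measure m1 m2]_z F z = \int[m2]_y \int[m1]_x F (x, y).
Proof.
move=> bF; rewrite /Rintegral.
rewrite -(@integral21_prod_meas1 _ _ _ _ _ m1 m2 _ (bounded_mfun_integrable
  (prod_measure m1 m2) bF)).
congr fine; apply: eq_integral => x _ /=; rewrite /fubini_G/=.
by rewrite -EFin_bounded_integral//; exact: bounded_mfun_yslice.
Qed.

Lemma bounded_Fubini F : bounded_mfun F ->
  \int[m1]_x \int[m2]_y F (x, y) = \int[m2]_y \int[m1]_x F (x, y).
Proof. by move=> bF; rewrite -integral_prod12// integral_prod21. Qed.

End bounded_fubini.

(** * Maximizing a linear functional over a convex set of functions *)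

Section maximization.
Context d (Z : measurableType d) (R : realType).
Variable m : {finite_measure set Z -> \bar R}.

(** The integrals of the |u (n+1) - u n| have a geometric bound, so the sum of
    these functions is integrable, hence finite almost everywhere. *)
Lemma ae_cvg_fast_cauchy (u : nat -> Z -> R) :
  (forall n, bounded_mfun (u n)) ->
  (forall n, \int[m]_z (u n.+1 z - u n z) ^+ 2 <= ((2 ^ n.+1)%:R^-1) ^+ 2) ->
  exists C, [/\ measurable C, m (~` C) = 0%E &
    forall z, C z -> cvgn (fun n => u n z)].
Proof.
move=> bu fast.
pose v n z := `|u n.+1 z - u n z|.
have bv n : bounded_mfun (v n) by apply/bounded_mfun_norm/bounded_mfunB.
pose w n : R := (2 ^ n.+1)%:R^-1.
pose B := (fine (m setT) + 1) / 2.
have mT0 : 0 <= fine (m setT) by rewrite fine_ge0.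
have int_v n : \int[m]_z v n z <= B / (2 ^ n.+1)%:R.
  have w0 : 0 < w n by rewrite invr_gt0 ltr0n expn_gt0.
  have bv2 : bounded_mfun (fun z => (u n.+1 z - u n z) ^+ 2).
    by under eq_fun do rewrite expr2; apply: bounded_mfunM;
      exact: bounded_mfunB.
  have bwv : bounded_mfun (fun z => (w n)^-1 / 2 * (u n.+1 z - u n z) ^+ 2).
    by apply: bounded_mfunM => //; exact: bounded_mfun_cst.
  (* arithmetic-geometric mean, with the weight that balances the two terms *)
  have : \int[m]_z v n z <=
      \int[m]_z (w n / 2 + (w n)^-1 / 2 * (u n.+1 z - u n z) ^+ 2).
    apply: bounded_le_integral => //.
      by apply: bounded_mfunD => //; exact: bounded_mfun_cst.
    move=> z; rewrite -real_normK ?num_real// -/(v n z).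
    have := sqr_ge0 (w n - v n z).
    rewrite sqrrB mulr2n => h; rewrite -(ler_pM2l (_ : 0 < 2 * w n));
      last by rewrite mulr_gt0.
    have -> : 2 * w n * (w n / 2 + (w n)^-1 / 2 * v n z ^+ 2) =
        w n ^+ 2 + v n z ^+ 2.
      by field; rewrite gt_eqF.
    by lra.
  move=> /le_trans; apply.
  rewrite bounded_integralD//; last exact: bounded_mfun_cst.
  rewrite Rintegral_cst// bounded_integralZ//.
  apply: (@le_trans _ _ (w n / 2 * fine (m setT) + (w n)^-1 / 2 * (w n) ^+ 2)).
    by rewrite lerD2l ler_wpM2l// ?divr_ge0// ?invr_ge0 ltW.
  rewrite le_eqVlt; apply/orP; left; apply/eqP.
  by rewrite -/(w n) /B; field; rewrite gt_eqF.
pose D z := (\sum_(n <oo) (v n z)%:E)%E.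
have v0 n z : (0 <= (v n z)%:E)%E by rewrite lee_fin normr_ge0.
have mv n : measurable_fun setT (fun z => (v n z)%:E).
  by apply/measurable_EFinP; case: (bv n).
have mD : measurable_fun setT D.
  by apply: ge0_emeasurable_sum => // n z _ _; exact: v0.
have D0 z : (0 <= D z)%E by apply: nneseries_ge0.
have intD : (\int[m]_z D z < +oo)%E.
  rewrite integral_nneseries//.
  apply: (@le_lt_trans _ _ (\sum_(n <oo) (B / (2 ^ n.+1)%:R)%:E)%E).
    apply: lee_nneseries => [n _ _|n _]; first by apply: integral_ge0 => z _.
    by rewrite -EFin_bounded_integral// lee_fin.
  apply: (@le_lt_trans _ _ B%:E); last exact: ltry.
  by apply: epsilon_trick0; rewrite /B divr_ge0// addr_ge0.
have iD : m.-integrable setT D.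
  apply/integrableP; split=> //.
  by under eq_integral do rewrite gee0_abs//.
have mC : measurable [set z | (D z < +oo)%E].
  by rewrite -[X in measurable X]setTI; exact: emeasurable_fun_infty_o.
exists [set z | (D z < +oo)%E]; split=> //.
  have [N [mN N0 CN]] := integrable_ae measurableT iD.
  apply: (subset_measure0 _ mN _ N0); first exact: measurableC.
  move=> z /= Dz; apply: CN => /= /(_ I) Dfin; apply: Dz.
  by rewrite -ge0_fin_numE.
move=> z /= Dz.
have sz : summable (fun n => is_true ((xpredT : pred nat) n))
    (fun n => (v n z)%:E).
  by rewrite /summable; under eq_esum do rewrite gee0_abs//;
    rewrite -nneseries_esum.
have cv := summable_cvg (fun n _ => v0 n z) sz.
have : cvgn (series (telescope (fun n => u n z))) by apply: normed_cvg.
rewrite telescopeK/= => cw.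
have -> : (fun n => u n z) = (fun n => (u n z - u 0%N z) + u 0%N z).
  by apply/funext => n; rewrite subrK.
by apply: is_cvgD => //; exact: is_cvg_cst.
Qed.

Definition unit_mfun : set (Z -> R) :=
  [set f : Z -> R | measurable_fun [set: Z] f /\ forall z, 0 <= f z <= 1].

Lemma unit_mfun_bounded f : unit_mfun f -> bounded_mfun f.
Proof. by move=> [mf f01]; exact: bounded_mfun01. Qed.

Definition midpoint_convex (V : set (Z -> R)) : Prop :=
  forall f g, V f -> V g -> V (fun z => (f z + g z) / 2).

(** Let r n be the infimum over V n of the squared L^2 norm; it increases with
    n to a finite limit.  Two elements of V n whose squared norms are within e
    of r n have a midpoint of squared norm at least r n, so the parallelogram
    law bounds the square of their distance by 4 e. *)
Lemma nested_convex_fast_cauchy (V : nat -> set (Z -> R)) :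
  (forall n, V n !=set0) -> (forall n, V n `<=` unit_mfun) ->
  (forall n, midpoint_convex (V n)) ->
  (forall n k, (n <= k)%N -> V k `<=` V n) ->
  exists u : nat -> Z -> R, (forall n, V n (u n)) /\
    forall n, \int[m]_z (u n.+1 z - u n z) ^+ 2 <= ((2 ^ n.+1)%:R^-1) ^+ 2.
Proof.
move=> V0 V01 Vmid Vnest.
pose N (f : Z -> R) := \int[m]_z f z ^+ 2.
have bf n f : V n f -> bounded_mfun f by move=> /V01/unit_mfun_bounded.
have bX2 f : bounded_mfun f -> bounded_mfun (fun z => f z ^+ 2).
  by move=> ?; under eq_fun do rewrite expr2; exact: bounded_mfunM.
have N0 f : 0 <= N f by apply: Rintegral_ge0 => z _; exact: sqr_ge0.
have NM n f : V n f -> N f <= fine (m setT).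
  move=> Vf; rewrite -[leRHS]mul1r -Rintegral_cst//.
  apply: bounded_le_integral; [by apply: bX2;
    exact: bf Vf|exact: bounded_mfun_cst|].
  by move=> z; have [_ /(_ z)/andP[? ?]] := V01 _ _ Vf; rewrite exprn_ile1.
pose r n := inf [set N f | f in V n].
have lbN n : has_lbound [set N f | f in V n] by exists 0 => _ [f _ <-].
have rN n f : V n f -> r n <= N f by move=> Vf; apply: ge_inf => //; exists f.
have hinf n : has_inf [set N f | f in V n].
  by split=> //; have [f Vf] := V0 n; exists (N f), f.
have hsup : has_sup (range r).
  split; first by exists (r 0%N), 0%N.
  exists (fine (m setT)) => _ [n _ <-]; have [f Vf] := V0 n.
  exact: le_trans (rN _ _ Vf) (NM _ _ Vf).
pose s := sup (range r).
have rs n : r n <= s by apply: sup_upper_bound => //; exists n.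
pose e k : R := ((2 ^ k.+1)%:R^-1) ^+ 2 / 8.
have e0 k : 0 < e k by rewrite divr_gt0// exprn_gt0// invr_gt0 ltr0n expn_gt0.
have edec k : e k.+1 <= e k.
  rewrite ler_wpM2r// ler_pXn2r// ?nnegrE ?invr_ge0//.
  by rewrite lef_pV2 ?posrE ?ltr0n ?expn_gt0// ler_nat leq_exp2l.
have /choice[nu nuP] k : exists n, s - e k < r n.
  by have [_ [n _ <-] ?] := sup_adherent (e0 k) hsup; exists n.
(* G dominates both k and nu, and is monotone, so that u k and u k.+1 lie in
   V (nu k), where r is within e k of its supremum *)
pose G k := (k + \sum_(i < k.+1) nu i)%N.
have Gk k : (k <= G k)%N by exact: leq_addr.
have nuG k : (nu k <= G k)%N.
  by rewrite /G big_ord_recr/= addnA leq_addl.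
have GS k : (G k <= G k.+1)%N.
  by rewrite /G [in leqRHS]big_ord_recr/= leq_add// leq_addr.
have /choice[u uP] k : exists f, V (G k) f /\ N f < r (G k) + e k.
  by have [_ [f Vf <-] ?] := inf_adherent (e0 k) (hinf (G k)); exists f.
have uV k : V (G k) (u k) by case: (uP k).
exists u; split=> k; first exact: Vnest (Gk k) _ (uV k).
have uk : V (nu k) (u k) by exact: Vnest (nuG k) _ (uV k).
have uk1 : V (nu k) (u k.+1).
  by apply: Vnest (uV k.+1); exact: leq_trans (nuG k) (GS k).
have mid := rN _ _ (Vmid _ _ _ uk uk1).
(* the parallelogram law *)
have -> : \int[m]_z (u k.+1 z - u k z) ^+ 2 =
    2 * N (u k) + 2 * N (u k.+1) - 4 * N (fun z => (u k z + u k.+1 z) / 2).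
  have b0 := bf _ _ uk; have b1 := bf _ _ uk1.
  have bm := bf _ _ (Vmid _ _ _ uk uk1).
  have bcM (c : R) f : bounded_mfun f -> bounded_mfun (fun z => c * f z).
    by move=> ?; apply: bounded_mfunM => //; exact: bounded_mfun_cst.
  rewrite -!bounded_integralZ; try exact: bX2.
  rewrite -bounded_integralD; try by apply: bcM; exact: bX2.
  rewrite -bounded_integralB; last 2 first.
  - by apply: bounded_mfunD; apply: bcM; exact: bX2.
  - by apply: bcM; exact: bX2.
  by apply: eq_Rintegral => z _ /=; field.
have [_ h0] := uP k; have [_ h1] := uP k.+1.
have := rs (G k); have := rs (G k.+1); have := nuP k; have := edec k.
move: mid h0 h1; rewrite (_ : _ ^+ 2 = 8 * e k); last by rewrite /e; field.
set q := N (fun z => _); set x := N (u k); set y := N (u k.+1).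
by move=> *; lra.
Qed.

(** Constraints that hold at every point, or on every section, need not survive
    a modification of a limit on a null set.  Cutting the sequence off outside a
    conull set C keeps upper bounds on nonnegative functions, and gives limits
    everywhere. *)
Definition ae_closed (K : set (Z -> R)) : Prop :=
  forall (u : nat -> Z -> R) (f : Z -> R) (C : set Z),
    (forall n, K (u n)) -> measurable C -> m (~` C) = 0%E ->
    (forall z, u n z * \1_C z @[n --> \oo] --> f z) -> K f.

Lemma cvg_integralM_ae (u : nat -> Z -> R) (f phi : Z -> R) (C : set Z) :
  (forall n, unit_mfun (u n)) -> bounded_mfun phi ->
  measurable C -> m (~` C) = 0%E ->
  (forall z, u n z * \1_C z @[n --> \oo] --> f z) ->
  \int[m]_z (u n z * phi z) @[n --> \oo] --> \int[m]_z (f z * phi z).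
Proof.
move=> u01 bphi mC C0 uf; have [_ [M phiM]] := bphi.
have bC : bounded_mfun (\1_C : Z -> R) by exact: bounded_mfun_indic.
have bu n : bounded_mfun (u n) by exact: unit_mfun_bounded.
have [||| _ +] := @cvg_integral _ _ _ m (fun n z => u n z * \1_C z * phi z)
  (fun z => f z * phi z) M.
- by move=> n; have [] := bounded_mfunM (bounded_mfunM (bu n) bC) bphi.
- move=> n z; rewrite !normrM -[leRHS]mul1r ler_pM//.
  have [_ /(_ z)/andP[u0 u1]] := u01 n.
  rewrite (ger0_norm u0) indicE.
  by case: (_ \in _); rewrite ?normr1 ?normr0 ?mulr1 ?mulr0.
- by move=> z; apply: cvgM; [exact: uf|exact: cvg_cst].
rewrite (_ : (fun n => \int[m]_z (u n z * \1_C z * phi z)) =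
    (fun n => \int[m]_z (u n z * phi z)))//.
apply/funext => n; apply: ae_eq_Rintegral.
- by apply: bounded_mfunM => //; exact: bounded_mfunM.
- exact: bounded_mfunM.
- exists (~` C); split=> //; first exact: measurableC.
  by move=> z /= neq Cz; apply: neq; rewrite indicE mem_set// mulr1.
Qed.

(** The sets V n of elements of K that maximize up to 1 / (n + 1) are nested and
    convex: they contain a fast Cauchy sequence, whose limit is a maximizer. *)
Lemma integral_maximizer (K : set (Z -> R)) (phi : Z -> R) :
  K !=set0 -> K `<=` unit_mfun -> midpoint_convex K -> ae_closed K ->
  bounded_mfun phi ->
  exists2 f, K f & forall g, K g ->
    \int[m]_z (g z * phi z) <= \int[m]_z (f z * phi z).
Proof.
move=> K0 K01 Kmid Kcl bphi; have [_ [B phiB]] := bphi.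
pose L (f : Z -> R) := \int[m]_z (f z * phi z).
have bK f : K f -> bounded_mfun f by move=> /K01/unit_mfun_bounded.
have hsup : has_sup [set L f | f in K].
  split; first by have [f Kf] := K0; exists (L f), f.
  exists (B * fine (m setT)) => _ [f Kf <-]; apply: le_trans (ler_norm _) _.
  apply: norm_integral_le; first by apply: bounded_mfunM => //; exact: bK.
  move=> z; rewrite normrM -[leRHS]mul1r ler_pM//.
  by have [_ /(_ z)/andP[? ?]] := K01 _ Kf; rewrite ger0_norm.
pose M := sup [set L f | f in K].
have LM g : K g -> L g <= M by move=> Kg; apply: sup_upper_bound => //;
  exists g.
pose V n : set (Z -> R) := [set f | K f /\ M - n.+1%:R^-1 <= L f].
have [||||u [uV ufast]] := @nested_convex_fast_cauchy V.
- move=> n; have n0 : 0 < n.+1%:R^-1 :> R by rewrite invr_gt0.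
  by have [_ [f Kf <-] /ltW h] := sup_adherent n0 hsup; exists f.
- by move=> n f [/K01].
- move=> n f g [Kf Lf] [Kg Lg]; split; first exact: Kmid.
  have -> : L (fun z => (f z + g z) / 2) = (L f + L g) / 2.
    rewrite mulrC /L -bounded_integralD; try by apply: bounded_mfunM => //;
      exact: bK.
    rewrite -bounded_integralZ; last first.
      by apply: bounded_mfunD; apply: bounded_mfunM => //; exact: bK.
    by apply: eq_Rintegral => z _; field.
  by rewrite ler_pdivlMr// mulr_natr mulr2n lerD.
- move=> n k nk f [Kf Lf]; split=> //; apply: le_trans Lf.
  by rewrite lerB// lef_pV2 ?posrE// ler_nat.
have uK n : K (u n) by case: (uV n).
have [C [mC C0 ucvg]] := ae_cvg_fast_cauchy (fun n => bK _ (uK n)) ufast.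
pose f z := lim (u n z * \1_C z @[n --> \oo]).
have uf z : u n z * \1_C z @[n --> \oo] --> f z.
  rewrite /f indicE; have [/set_mem Cz|nCz] := boolP (z \in C).
    by apply: is_cvgM; [exact: ucvg|exact: is_cvg_cst].
  by under eq_fun do rewrite mulr0; exact: is_cvg_cst.
exists f; first exact: Kcl uK mC C0 uf.
move=> g Kg; apply: le_trans (LM _ Kg) _.
have Lf := cvg_integralM_ae (fun n => K01 _ (uK n)) bphi mC C0 uf.
have cM : M - n.+1%:R^-1 @[n --> \oo] --> M.
  rewrite -[X in _ --> X]subr0; apply: cvgB; first exact: cvg_cst.
  exact: cvg_harmonic.
rewrite -(cvg_lim _ cM)// -(cvg_lim _ Lf)//.
apply: ler_lim; [by apply/cvg_ex; exists M|by apply/cvg_ex; eexists;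
  exact: Lf|].
by apply: nearW => n; case: (uV n).
Qed.

End maximization.

(** * Perturbations with vanishing marginals *)

Ltac measurable_projection := repeat first
  [ exact: measurable_cst | exact: measurable_id | exact: measurable_fst |
    exact: measurable_snd
  | apply: measurable_fun_pair
  | apply: (measurableT_comp measurable_fst)
  | apply: (measurableT_comp measurable_snd)].

Lemma measurable_eq_fun d (X : measurableType d) (R : realType) (f g : X -> R) :
  measurable_fun [set: X] f -> measurable_fun [set: X] g ->
  measurable [set x | f x = g x].
Proof.
move=> mf mg; rewrite (_ : [set _ | _] = (f \- g) @^-1` [set 0]).
  by rewrite -[X in measurable X]setTI; apply: measurable_funB.
apply/seteqP; split=> x /=; first by move=> ->; rewrite subrr.
by move=> /eqP; rewrite subr_eq0 => /eqP.
Qed.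

Section symmetrization.
Context d (X : measurableType d) (R : realType).
Variable m : {finite_measure set X -> \bar R}.

Lemma integral_antisym (F : X * X -> R) : bounded_mfun F ->
  (forall x y, F (y, x) = - F (x, y)) -> \int[m]_x \int[m]_y F (x, y) = 0.
Proof.
move=> bF Fanti; set I := LHS.
suff : I = - I by move=> h; lra.
rewrite {1}/I bounded_Fubini// -[RHS]mulN1r /I.
rewrite -bounded_integralZ; last exact: bounded_mfun_int2.
apply: eq_Rintegral => y _; rewrite -bounded_integralZ;
  last exact: bounded_mfun_xslice.
by apply: eq_Rintegral => x _; rewrite Fanti mulN1r.
Qed.

Variables (p : X -> R) (D : X * X -> R).
Hypotheses (bp : bounded_mfun p) (bD : bounded_mfun D).
Hypotheses (D0 : forall z, 0 <= D z) (Dsym : forall x y, D (y, x) = D (x, y)).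

Let bp1 : bounded_mfun (fun z : X * X => p z.1).
Proof. by apply: bounded_mfun_comp bp; measurable_projection. Qed.

Let bp2 : bounded_mfun (fun z : X * X => p z.2).
Proof. by apply: bounded_mfun_comp bp; measurable_projection. Qed.

Let bE : bounded_mfun (fun z => (p z.1 - p z.2) ^+ 2 * D z).
Proof.
apply: bounded_mfunM => //; under eq_fun do rewrite expr2.
by apply: bounded_mfunM; exact: bounded_mfunB.
Qed.

(** The two integrands differ by (p(x)^2 - p(y)^2) D(x,y) / 2, which is
    antisymmetric. *)
Lemma integral_sym_difference :
  \int[m]_x \int[m]_y (p x * (p x - p y) * D (x, y)) =
  2^-1 * \int[prod_measure m m]_z ((p z.1 - p z.2) ^+ 2 * D z).
Proof.
have bF : bounded_mfun (fun z => p z.1 * (p z.1 - p z.2) * D z).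
  by apply: bounded_mfunM => //; apply: bounded_mfunM => //;
    exact: bounded_mfunB.
have bE2 : bounded_mfun (fun z => 2^-1 * ((p z.1 - p z.2) ^+ 2 * D z)).
  by apply: bounded_mfunM => //; exact: bounded_mfun_cst.
rewrite -bounded_integralZ//; apply/eqP; rewrite -subr_eq0; apply/eqP.
rewrite -(integral_prod12 m m bF) -bounded_integralB//.
rewrite (integral_prod12 _ _ (bounded_mfunB bF bE2)).
apply: (integral_antisym (bounded_mfunB bF bE2)).
by move=> x y /=; rewrite Dsym; field.
Qed.

Lemma integral_sym_difference_ge0 :
  0 <= \int[m]_x \int[m]_y (p x * (p x - p y) * D (x, y)).
Proof.
rewrite integral_sym_difference mulr_ge0//; apply: Rintegral_ge0 => z _.
by rewrite mulr_ge0// sqr_ge0.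
Qed.

Lemma integral_sym_difference_eq0 :
  prod_measure m m [set z | p z.1 = p z.2] = 0%E ->
  \int[m]_x \int[m]_y (p x * (p x - p y) * D (x, y)) = 0 ->
  \int[m]_x \int[m]_y D (x, y) = 0.
Proof.
move=> diag0 /eqP; rewrite integral_sym_difference mulf_eq0 invr_eq0
  pnatr_eq0/=.
move=> /eqP /(integral0_ae bE) ae0.
rewrite -integral_prod12//.
transitivity (\int[prod_measure m m]_z (0 : R));
  last by rewrite Rintegral_cst// mul0r.
apply: ae_eq_Rintegral => //; first exact: bounded_mfun_cst.
have : {ae prod_measure m m, forall z, p z.1 <> p z.2}.
  exists [set z | p z.1 = p z.2]; split=> //.
    by apply: measurable_eq_fun; [case: bp1|case: bp2].
  by move=> z /= /contrapT.
have {}ae0 := ae0 (fun z => mulr_ge0 (sqr_ge0 _) (D0 z)).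
apply: filterS2 ae0 => z /eqP;
  rewrite mulf_eq0 sqrf_eq0 subr_eq0 => /orP[/eqP //|/eqP //].
Qed.

End symmetrization.

Section perturbation.
Context d1 d2 (S : measurableType d1) (T : measurableType d2) (R : realType).
Variables (nu : {finite_measure set S -> \bar R})
          (eta : {finite_measure set T -> \bar R}).

(** The product a g is the superposition of signed rectangles h of the
    introduction.  Its marginals vanish by antisymmetry, in (s,s') for fixed t
    and in (t,t') for fixed s.  Its integral against p q is symmetrized first in
    (t,t') for fixed s and s', then in (s,s').  If it is zero, both
    symmetrizations are degenerate: with G s s' t = a(s,t) a(s',t), the square
    of int G s s' t dt vanishes for almost all (s,s'), hence so does the double
    integral over (s,s') of int G s s' t dt, which is the integral over t of the
    square of int a(s,t) ds. *)
Lemma marginal_free_perturbation (a : S * T -> R) (p : S -> R) (q : T -> R) :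
  bounded_mfun a -> (forall z, 0 <= a z) ->
  bounded_mfun p -> bounded_mfun q ->
  prod_measure nu nu [set z | p z.1 = p z.2] = 0%E ->
  prod_measure eta eta [set z | q z.1 = q z.2] = 0%E ->
  exists g : S * T -> R, [/\ bounded_mfun g,
    forall t, \int[nu]_s (a (s, t) * g (s, t)) = 0,
    forall s, \int[eta]_t (a (s, t) * g (s, t)) = 0 &
    0 < \int[prod_measure nu eta]_z a z ->
    0 < \int[prod_measure nu eta]_z (a z * g z * (p z.1 * q z.2))].
Proof.
move=> ba a0 bp bq pdiag qdiag.
pose G s s' t := a (s, t) * a (s', t).
have GC s s' t : G s' s t = G s s' t by rewrite /G mulrC.
have G0 s s' t : 0 <= G s s' t by exact: mulr_ge0.
have bG s s' : bounded_mfun (G s s').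
  by apply: bounded_mfunM; exact: bounded_mfun_xslice.
pose K s s' t := \int[eta]_t' ((q t - q t') * G s s' t').
have KC s s' t : K s' s t = K s s' t.
  by apply: eq_Rintegral => t' _; rewrite GC.
have bK3 : bounded_mfun (fun z : S * S * T => K z.1.1 z.1.2 z.2).
  apply: (@bounded_mfun_int2 _ _ _ _ _ eta
    (fun z : S * S * T * T => (q z.1.2 - q z.2) * G z.1.1.1 z.1.1.2 z.2)).
  apply: bounded_mfunM; first apply: bounded_mfunB.
  - by apply: (bounded_mfun_comp _ bq); measurable_projection.
  - by apply: (bounded_mfun_comp _ bq); measurable_projection.
  - by apply: bounded_mfunM; apply: (bounded_mfun_comp _ ba);
    measurable_projection.
have bK s s' : bounded_mfun (K s s').
  exact: (bounded_mfun_xslice (s, s') bK3).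
pose g z := \int[nu]_s' ((p z.1 - p s') * a (s', z.2) * K z.1 s' z.2).
pose W s s' t := (p s - p s') * (G s s' t * K s s' t).
have bW : bounded_mfun (fun z : S * S * T => W z.1.1 z.1.2 z.2).
  apply: bounded_mfunM; first apply: bounded_mfunB.
  - by apply: (bounded_mfun_comp _ bp); measurable_projection.
  - by apply: (bounded_mfun_comp _ bp); measurable_projection.
  apply: bounded_mfunM => //.
  by apply: bounded_mfunM; apply: (bounded_mfun_comp _ ba);
    measurable_projection.
have bg3 : bounded_mfun (fun z : S * T * S =>
    (p z.1.1 - p z.2) * a (z.2, z.1.2) * K z.1.1 z.2 z.1.2).
  apply: bounded_mfunM; last first.
    by apply: (bounded_mfun_comp (k := fun z : S * T * S =>
      (z.1.1, z.2, z.1.2)) _ bK3);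
      measurable_projection.
  apply: bounded_mfunM; first apply: bounded_mfunB.
  - by apply: (bounded_mfun_comp _ bp); measurable_projection.
  - by apply: (bounded_mfun_comp _ bp); measurable_projection.
  - by apply: (bounded_mfun_comp _ ba); measurable_projection.
have bg : bounded_mfun g by exact: (bounded_mfun_int2 nu bg3).
have agE s t : a (s, t) * g (s, t) = \int[nu]_s' W s s' t.
  rewrite -bounded_integralZ; last exact: (bounded_mfun_xslice (s, t) bg3).
  by apply: eq_Rintegral => s' _; rewrite /W /G /=; ring.
have GGq0 s s' : \int[eta]_t (G s s' t * K s s' t) = 0.
  transitivity (\int[eta]_t \int[eta]_t'
      ((q t - q t') * (G s s' t * G s s' t'))).
    apply: eq_Rintegral => t _; rewrite -bounded_integralZ.
      by apply: eq_Rintegral => t' _; ring.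
    apply: bounded_mfunM; last exact: bG.
    by apply: bounded_mfunB => //; exact: bounded_mfun_cst.
  apply: (@integral_antisym _ _ _ eta
    (fun z => (q z.1 - q z.2) * (G s s' z.1 * G s s' z.2)));
      last by move=> x y /=; ring.
  apply: bounded_mfunM; first apply: bounded_mfunB.
  - by apply: (bounded_mfun_comp _ bq); measurable_projection.
  - by apply: (bounded_mfun_comp _ bq); measurable_projection.
  by apply: bounded_mfunM; apply: (bounded_mfun_comp _ (bG s s'));
    measurable_projection.
exists g; split=> //.
- move=> t; under eq_Rintegral do rewrite agE.
  apply: (@integral_antisym _ _ _ nu (fun z => W z.1 z.2 t)).
    exact: (bounded_mfun_yslice t bW).
  by move=> s s' /=; rewrite /W GC KC; ring.
- move=> s; under eq_Rintegral do rewrite agE.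
  rewrite (@bounded_Fubini _ _ _ _ _ eta nu (fun z => W s z.2 z.1)); last first.
    by apply: (bounded_mfun_comp (k := fun z : T * S => (s, z.2, z.1)) _ bW);
      measurable_projection.
  transitivity (\int[nu]_s' (0 : R)); last by rewrite Rintegral_cst// mul0r.
  apply: eq_Rintegral => s' _ /=; rewrite bounded_integralZ ?GGq0 ?mulr0//.
  exact: bounded_mfunM.
(* the result of integrating out t and t'; it plays the role of the symmetric
   weight in the variables s and s' *)
pose D (z : S * S) := \int[eta]_t (q t * (G z.1 z.2 t * K z.1 z.2 t)).
have bGG s s' : bounded_mfun (fun z : T * T => G s s' z.1 * G s s' z.2).
  by apply: bounded_mfunM; apply: (bounded_mfun_comp _ (bG s s'));
    measurable_projection.
have DE s s' : D (s, s') = \int[eta]_t \int[eta]_t'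
    (q t * (q t - q t') * (G s s' t * G s s' t')).
  apply: eq_Rintegral => t _; rewrite mulrA -bounded_integralZ.
    by apply: eq_Rintegral => t' _ /=; ring.
  apply: bounded_mfunM; last exact: bG.
  by apply: bounded_mfunB => //; exact: bounded_mfun_cst.
have D0 z : 0 <= D z.
  case: z => s s'; rewrite DE;
    apply: (integral_sym_difference_ge0 eta bq (bGG s s')).
    by move=> z; exact: mulr_ge0.
  by move=> x y /=; rewrite mulrC.
have bD : bounded_mfun D.
  apply: (@bounded_mfun_int2 _ _ _ _ _ eta
    (fun z : S * S * T => q z.2 * (G z.1.1 z.1.2 z.2 * K z.1.1 z.1.2 z.2))).
  apply: bounded_mfunM; first by apply: (bounded_mfun_comp _ bq);
    measurable_projection.
  apply: bounded_mfunM => //.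
  by apply: bounded_mfunM; apply: (bounded_mfun_comp _ ba);
    measurable_projection.
have DC s s' : D (s', s) = D (s, s').
  by apply: eq_Rintegral => t _ /=; rewrite GC KC.
have IE : \int[prod_measure nu eta]_z (a z * g z * (p z.1 * q z.2)) =
    \int[nu]_s \int[nu]_s' (p s * (p s - p s') * D (s, s')).
  have bpq : bounded_mfun (fun z : S * T => a z * g z * (p z.1 * q z.2)).
    apply: bounded_mfunM; first exact: bounded_mfunM.
    apply: bounded_mfunM; first by apply: (bounded_mfun_comp _ bp);
      measurable_projection.
    by apply: (bounded_mfun_comp _ bq); measurable_projection.
  rewrite integral_prod12//; apply: eq_Rintegral => s _ /=.
  transitivity (\int[eta]_t \int[nu]_s' (p s * q t * W s s' t)).
    apply: eq_Rintegral => t _; rewrite agE mulrC -bounded_integralZ//.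
    by apply: (bounded_mfun_comp (k := fun s' => (s, s', t)) _ bW);
      measurable_projection.
  rewrite (@bounded_Fubini _ _ _ _ _ eta nu (fun z =>
    p s * q z.1 * W s z.2 z.1)).
    apply: eq_Rintegral => s' _ /=; rewrite -bounded_integralZ.
      by apply: eq_Rintegral => t _; rewrite /W /=; ring.
    by apply: bounded_mfunM => //; exact: bounded_mfunM.
  apply: bounded_mfunM; last first.
    by apply: (bounded_mfun_comp (k := fun z : T * S => (s, z.2, z.1)) _ bW);
      measurable_projection.
  apply: bounded_mfunM; first exact: bounded_mfun_cst.
  by apply: (bounded_mfun_comp _ bq); measurable_projection.
rewrite IE => ia; rewrite lt_neqAle integral_sym_difference_ge0// andbT.
apply/negP => /eqP/esym I0.
have int_square d (X : measurableType d) (m : {finite_measure set X -> \bar R})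
    (F : X -> R) : bounded_mfun F ->
    \int[m]_x \int[m]_y (F x * F y) = (\int[m]_x F x) ^+ 2.
  move=> bF; rewrite expr2 -bounded_integralZ//; apply: eq_Rintegral => x _.
  by rewrite bounded_integralZ// mulrC.
have bG3 : bounded_mfun (fun z : S * S * T => G z.1.1 z.1.2 z.2).
  by apply: bounded_mfunM; apply: (bounded_mfun_comp _ ba);
    measurable_projection.
have bH : bounded_mfun (fun z : S * S => \int[eta]_t G z.1 z.2 t).
  exact: (bounded_mfun_int2 eta bG3).
have HD z : D z = 0 -> \int[eta]_t G z.1 z.2 t = 0.
  case: z => s s' /=; rewrite DE =>
    /(integral_sym_difference_eq0 bq (bGG s s')).
  rewrite int_square// => h; apply/eqP; rewrite -sqrf_eq0; apply/eqP/h => //.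
  - by move=> z; exact: mulr_ge0.
  - by move=> x y /=; rewrite mulrC.
have IH : \int[prod_measure nu nu]_z \int[eta]_t G z.1 z.2 t = 0.
  transitivity (\int[prod_measure nu nu]_z (0 : R));
    last by rewrite Rintegral_cst// mul0r.
  apply: ae_eq_Rintegral => //; first exact: bounded_mfun_cst.
  apply: filterS HD _; apply: integral0_ae => //.
  by rewrite integral_prod12//;
    exact: integral_sym_difference_eq0 bp bD D0 DC pdiag I0.
have bA : bounded_mfun (fun t => \int[nu]_s a (s, t))
  by exact: bounded_mfun_int1.
move: IH; rewrite (bounded_Fubini (prod_measure nu nu) eta bG3).
under eq_Rintegral => t _.
  rewrite (integral_prod12 nu nu (bounded_mfun_yslice t bG3))/= /G int_square;
    last first.
    exact: bounded_mfun_yslice.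
  over.
move=> /integral0_ae A0; move: ia; rewrite integral_prod21// => /lt0r_neq0/eqP;
  apply.
transitivity (\int[eta]_t (0 : R)); last by rewrite Rintegral_cst// mul0r.
apply: ae_eq_Rintegral => //; first exact: bounded_mfun_cst.
apply: filterS (A0 _ _) => [t /eqP||t]; last exact: sqr_ge0.
  by rewrite sqrf_eq0 => /eqP.
by under eq_fun do rewrite expr2; exact: bounded_mfunM.
Qed.

End perturbation.

(** * Injective coordinates on an atomless standard Borel space *)

Section ternary_code.
Context d (X : measurableType d) (R : realType).
Variable P : nat -> set X.
Hypothesis mP : forall n, measurable (P n).

Let c x n : R := \1_(P n) x * 3^-1 ^+ n.

Let c0 x n : 0 <= c x n.
Proof. by rewrite mulr_ge0// ?exprn_ge0// indicE. Qed.

Let c1 x n : c x n <= 3^-1 ^+ n.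
Proof.
by rewrite ler_piMl ?exprn_ge0// indicE; case: (_ \in _).
Qed.

Let tail x n j : series (c x) (n + j)%N <=
  series (c x) n + 3^-1 ^+ n * (3 / 2) * (1 - 3^-1 ^+ j).
Proof.
elim: j => [|j IH]; first by rewrite addn0 expr0 subrr mulr0 addr0.
rewrite addnS seriesSr; have := c1 x (n + j)%N.
move: IH; rewrite exprD exprS.
set A := 3^-1 ^+ n; set B := 3^-1 ^+ j; move=> h1 h2.
apply: le_trans (lerD h1 h2) _.
by rewrite le_eqVlt; apply/orP; left; apply/eqP; field.
Qed.

Let nd x : nondecreasing_seq (series (c x)).
Proof. by apply: nondecreasing_series => n _ _. Qed.

Let ub x n j : series (c x) j <= series (c x) n + 3^-1 ^+ n * (3 / 2).
Proof.
have [jn|nj] := leqP j n.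
  apply: le_trans (nd x jn) _.
  by rewrite lerDl mulr_ge0// exprn_ge0.
rewrite -(subnKC (ltnW nj)); apply: le_trans (tail _ _ _) _.
by rewrite lerD2l ler_piMr ?mulr_ge0 ?exprn_ge0// gerBl exprn_ge0.
Qed.

Let ub0 x j : series (c x) j <= 3 / 2.
Proof.
have := ub x 0 j.
by rewrite (_ : series (c x) 0%N = 0) ?add0r ?expr0 ?mul1r// /series/= big_geq.
Qed.

Let cv x : cvgn (series (c x)).
Proof.
apply: nondecreasing_is_cvgn => //.
by exists (3 / 2) => _ [j _ <-]; exact: ub0.
Qed.

(** With base 3, the first digit in which two codes differ outweighs all later
    ones, so a separating sequence of sets gives an injective code. *)
Definition ternary_code (x : X) : R := limn (series (c x)).

Lemma bounded_mfun_ternary_code : bounded_mfun ternary_code.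
Proof.
split.
  apply: (@measurable_fun_cvg _ _ _ _ (fun n x => series (c x) n)).
    move=> n; apply: measurable_sum => k.
    by apply: measurable_funM => //; exact: measurable_indic.
  by move=> x _; exact: cv.
exists (3 / 2) => x; rewrite ger0_norm.
  apply: limr_le; first exact: cv.
  by apply: nearW => j; exact: ub0.
apply: limr_ge; first exact: cv.
by apply: nearW => j; rewrite sumr_ge0.
Qed.

Let lt_code x y n : (forall k, (k < n)%N -> P k x <-> P k y) ->
  P n x -> ~ P n y -> ternary_code y < ternary_code x.
Proof.
move=> agree Pnx Pny.
have sE : series (c x) n = series (c y) n.
  apply: eq_big_nat => k /andP[_ kn]; rewrite /c !indicE.
  suff -> : (x \in P k) = (y \in P k) by [].
  by apply/idP/idP => /set_mem h; apply/mem_set; exact/(agree _ kn).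
apply: (@lt_le_trans _ _ (series (c x) n + 3^-1 ^+ n)); last first.
  apply: le_trans (nondecreasing_cvgn_le (@nd x) (@cv x) n.+1).
  by rewrite seriesSr /c indicE mem_set// mul1r.
apply: (@le_lt_trans _ _ (series (c y) n + 3^-1 ^+ n / 2)).
  apply: limr_le; first exact: cv.
  apply: nearW => j; apply: le_trans (ub y n.+1 j) _.
  rewrite seriesSr {2}/c indicE memNset// mul0r addr0 lerD2l exprS.
  by rewrite le_eqVlt; apply/orP; left; apply/eqP; field.
by rewrite sE ltrD2l ltr_pdivrMr// ltr_pMr ?exprn_gt0// ltr1n.
Qed.

Lemma ternary_code_inj : (forall x y, (forall n, P n x <-> P n y) -> x = y) ->
  injective ternary_code.
Proof.
move=> sep x y cxy; apply: sep.
apply: contrapT => /existsNP Pxy.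
have exn : exists n, ~~ `[< P n x <-> P n y >].
  by have [n Pn] := Pxy; exists n; apply/negP => /asboolP.
case: (ex_minnP exn) => n /negP nPn nmin.
have agree k : (k < n)%N -> P k x <-> P k y.
  by move=> kn; apply/asboolP; apply: contraT => /nmin; rewrite leqNgt kn.
have [Pnx|nPnx] := pselect (P n x).
  have := @lt_code x y n agree Pnx; rewrite cxy ltxx => h.
  by apply: nPn; apply/asboolP; split=> // _; apply: contrapT => /h.
have [Pny|nPny] := pselect (P n y).
  have := @lt_code y x n (fun k kn => iff_sym (agree k kn)) Pny nPnx.
  by rewrite cxy ltxx.
by apply: nPn; apply/asboolP; split.
Qed.

End ternary_code.

Section standard_borel_code.
Context {R : realType}.

(** Open balls of radii 1 / (k + 1) around the points of a countable dense set
    separate points; the ternary code of membership in them is injective. *)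
Lemma standard_borel_code d (T : measurableType d) :
  standard_borel (R := R) T ->
  exists p : T -> R, bounded_mfun p /\ injective p.
Proof.
move=> [X [_ [Q Qcount Qdense] [f [g [fgK _ mf _]]]]].
have [i iinj] : exists i : X -> nat, {in Q &, injective i}.
  by have /countable_injP[i iinj] := Qcount; exists i.
(* the ball around the n-th point of the dense set; the union, over at most
   one x, avoids choosing that point *)
pose U (n k : nat) : set X :=
  \bigcup_(x in [set x | Q x /\ i x = n]) [set y | mdist x y < k.+1%:R^-1].
have oU n k : open (U n k).
  apply: bigcup_open => x _; rewrite openE => y /= xy.
  rewrite /interior; apply/nbhs_ballP; exists (k.+1%:R^-1 - mdist x y).
    by rewrite /= subr_gt0.
  move=> z; rewrite ballEmdist/= ltrBrDl => yz.
  by apply: le_lt_trans yz; exact: metric_triangle.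
pose P n : set T := if unpickle n is Some nk then f @^-1` U nk.1 nk.2 else set0.
exists (ternary_code R P); split.
  apply: bounded_mfun_ternary_code => n; rewrite /P.
  case: (unpickle n) => [nk|//].
  by apply: mf; apply: sub_sigma_algebra; exact: oU.
apply: ternary_code_inj => s t Pst; apply: (can_inj fgK).
apply: mdist_positivity; apply: contrapT => /eqP dne0.
have dst0 : 0 < mdist (f s) (f t) by rewrite lt_neqAle eq_sym dne0 mdist_ge0.
(* a ball around a point of the dense set, of radius at most half the distance,
   contains f s but not f t *)
have [k kd] : exists k : nat, k.+1%:R^-1 < mdist (f s) (f t) / 2.
  have : 0 < mdist (f s) (f t) / 2 by rewrite divr_gt0.
  by move=> /ltr_add_invr[k]; rewrite add0r; exists k.
have [x [sx Qx]] : [set y | mdist (f s) y < k.+1%:R^-1] `&` Q !=set0.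
  apply: Qdense; last first.
    rewrite openE => y /= xy.
    rewrite /interior; apply/nbhs_ballP; exists (k.+1%:R^-1 - mdist (f s) y).
      by rewrite /= subr_gt0.
    move=> z; rewrite ballEmdist/= ltrBrDl => yz.
    by apply: le_lt_trans yz; exact: metric_triangle.
  by exists (f s); rewrite /= mdistxx.
have := Pst (pickle (i x, k)); rewrite /P pickleK /= => -[+ _].
case; first by exists x => //=; rewrite metric_sym.
move=> x' [Qx' ix'] /= x't.
have xx' : x' = x by apply: iinj; rewrite ?inE.
rewrite xx' in x't.
have := le_lt_trans (metric_triangle (f s) x (f t)) (ltrD sx x't).
by move=> /lt_trans/(_ (ltrD kd kd)); rewrite -splitr ltxx.
Qed.

(** An atomless measure vanishes on singletons, which are measurable as level
    sets of p; the diagonal then has null sections. *)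
Lemma atomless_diagonal d (T : measurableType d)
    (m : {finite_measure set T -> \bar R}) (p : T -> R) :
  atomless m -> measurable_fun [set: T] p -> injective p ->
  prod_measure m m [set z | p z.1 = p z.2] = 0%E.
Proof.
move=> matomless mp pinj.
have point0 x : m [set y | p x = p y] = 0%E.
  apply: contrapT => /eqP mx0.
  have mpt : measurable [set y | p x = p y].
    by apply: measurable_eq_fun => //; exact: measurable_cst.
  have : (0 < m [set y | p x = p y])%E by rewrite lt0e mx0 measure_ge0.
  move=> /(matomless _ mpt)[B [mB Bx /andP[B0 Blt]]].
  have [y By] : B !=set0.
    by apply/set0P; apply: contraTneq B0 => ->; rewrite measure0 ltxx.
  suff BE : B = [set y | p x = p y] by move: Blt; rewrite BE ltxx.
  apply/seteqP; split=> // z /= pxz; have pxy := Bx _ By.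
  by rewrite (_ : z = y)//; apply: pinj; rewrite -pxz -pxy.
rewrite /prod_measure /product_measure1/=; apply: integral0_eq => x _ /=.
rewrite -(point0 x); congr (m _).
by apply/seteqP; split=> y; rewrite /xsection/= inE.
Qed.

End standard_borel_code.

(** * Fractional solutions *)

Section fractional.
Context d1 d2 (S : measurableType d1) (T : measurableType d2) (R : realType).
Variables (nu : {finite_measure set S -> \bar R})
          (eta : {finite_measure set T -> \bar R}).
Variables (E : set (S * T)) (b : T -> R) (c : S -> R).
Local Notation mu := (prod_measure nu eta).

Definition fractional : set (S * T -> R) :=
  [set f | [/\ unit_mfun f, forall z, ~ E z -> f z = 0,
               forall t, \int[nu]_s f (s, t) <= b t &
               forall s, \int[eta]_t f (s, t) <= c s]].

Lemma fractional_midpoint : midpoint_convex fractional.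
Proof.
move=> f g [uf fE fb fc] [ug gE gb gc].
have bf := unit_mfun_bounded uf; have bg := unit_mfun_bounded ug.
have int_mid d (X : measurableType d) (m : {finite_measure set X -> \bar R})
    (u v : X -> R) (r : R) : bounded_mfun u -> bounded_mfun v ->
    \int[m]_x u x <= r -> \int[m]_x v x <= r -> \int[m]_x ((u x + v x) / 2) <=
      r.
  move=> bu bv ur vr.
  have -> : \int[m]_x ((u x + v x) / 2) = 2^-1 * (\int[m]_x u x + \int[m]_x v
    x).
    rewrite -bounded_integralD// -bounded_integralZ; last exact: bounded_mfunD.
    by apply: eq_Rintegral => x _; rewrite mulrC.
  by lra.
split.
- split.
    case: bf => mf _; case: bg => mg _.
    by apply: measurable_funM; [exact: measurable_funD|exact: measurable_cst].
  by move=> z; have [_ /(_ z)] := uf; have [_ /(_ z)] := ug; lra.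
- by move=> z nEz; rewrite fE// gE// addr0 mul0r.
- by move=> t; apply: int_mid => //; exact: bounded_mfun_yslice.
- by move=> s; apply: int_mid => //; exact: bounded_mfun_xslice.
Qed.

(** Cutting off by the indicator of C only decreases the section integrals, and
    bounded convergence applies on every section. *)
Lemma fractional_ae_closed : ae_closed mu fractional.
Proof.
move=> u f C uK mC _ uf.
have bC : bounded_mfun (\1_C : S * T -> R) by exact: bounded_mfun_indic.
pose w n z := u n z * \1_C z.
have w01 n z : 0 <= w n z <= u n z.
  have [[_ /(_ z)/andP[u0 u1]] _ _ _] := uK n.
  by rewrite /w indicE; case: (_ \in _); rewrite ?mulr1 ?mulr0 lexx ?u0.
have bu n : bounded_mfun (u n) by have [+ _ _ _] := uK n;
  exact: unit_mfun_bounded.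
have bw n : bounded_mfun (w n) by exact: bounded_mfunM.
have w1 n z : `|w n z| <= 1.
  have /andP[w0 wu] := w01 n z; have [[_ /(_ z)/andP[_ u1]] _ _ _] := uK n.
  by rewrite ger0_norm//; exact: le_trans u1.
have lim_le d (X : measurableType d) (m : {finite_measure set X -> \bar R})
    (v w' : nat -> X -> R) (h : X -> R) (r : R) :
    (forall n, bounded_mfun (v n)) -> (forall n, bounded_mfun (w' n)) ->
    (forall n x, w' n x <= v n x) ->
    (forall n x, `|w' n x| <= 1) -> (forall n, \int[m]_x v n x <= r) ->
    (forall x, w' n x @[n --> \oo] --> h x) -> \int[m]_x h x <= r.
  move=> bv bw' wv w'1 vr wh.
  have [_ cw] := cvg_integral m (fun n => (bw' n).1) w'1 wh.
  rewrite -(cvg_lim _ cw)//; apply: limr_le.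
    by apply/cvg_ex; eexists; exact: cw.
  by apply: nearW => n; apply: le_trans (vr n); exact: bounded_le_integral.
split.
- split.
    by apply: (measurable_fun_cvg (fun n => (bw n).1)) => z _; exact: uf.
  move=> z; rewrite -(cvg_lim _ (uf z))//.
  have cz : cvgn (fun n => w n z) by apply/cvg_ex; eexists; exact: uf.
  apply/andP; split.
    by apply: limr_ge => //; apply: nearW => n; case/andP: (w01 n z).
  apply: limr_le => //; apply: nearW => n.
  by apply: le_trans (w1 n z); exact: ler_norm.
- move=> z nEz; rewrite -(cvg_lim _ (uf z))//.
  rewrite (_ : (fun n => _) = fun=> 0); first exact: lim_cst.
  by apply/funext => n; have [_ uE _ _] := uK n; rewrite uE// mul0r.
- move=> t; apply: (lim_le _ _ nu (fun n s => u n (s, t)) (fun n s =>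
  w n (s, t))).
  + by move=> n; exact: bounded_mfun_yslice.
  + by move=> n; exact: bounded_mfun_yslice.
  + by move=> n s; case/andP: (w01 n (s, t)).
  + by move=> n s; exact: w1.
  + by move=> n; have [_ _ ub _] := uK n.
  + by move=> s; exact: uf.
- move=> s; apply: (lim_le _ _ eta (fun n t => u n (s, t)) (fun n t =>
  w n (s, t))).
  + by move=> n; exact: bounded_mfun_xslice.
  + by move=> n; exact: bounded_mfun_xslice.
  + by move=> n t; case/andP: (w01 n (s, t)).
  + by move=> n t; exact: w1.
  + by move=> n; have [_ _ _ uc] := uK n.
  + by move=> t; exact: uf.
Qed.

Definition optimal_fractional : set (S * T -> R) :=
  [set f | fractional f /\
    forall g, fractional g -> \int[mu]_z g z <= \int[mu]_z f z].

Lemma optimal_fractional_maximizer (phi : S * T -> R) :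
  (forall t, 0 <= b t) -> (forall s, 0 <= c s) -> bounded_mfun phi ->
  exists2 f, optimal_fractional f & forall g, optimal_fractional g ->
    \int[mu]_z (g z * phi z) <= \int[mu]_z (f z * phi z).
Proof.
move=> b0 c0 bphi.
have b1 : bounded_mfun (fun _ : S * T => 1 : R) by exact: bounded_mfun_cst.
have mul1 (f : S * T -> R) : \int[mu]_z f z = \int[mu]_z (f z * 1).
  by apply: eq_Rintegral => z _; rewrite mulr1.
have K01 : fractional `<=` @unit_mfun _ _ _ by move=> f [].
apply: integral_maximizer => //.
- have [|f Kf fmax] := integral_maximizer _ K01 fractional_midpoint
    fractional_ae_closed b1.
    exists (fun=> 0); split=> //.
    + by split=> [|z]; rewrite ?lexx ?ler01//; exact: measurable_cst.
    + by move=> t; rewrite Rintegral_cst// mul0r.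
    + by move=> s; rewrite Rintegral_cst// mul0r.
  by exists f; split=> // g Kg; rewrite (mul1 g) (mul1 f); exact: fmax.
- by move=> f [/K01].
- move=> f g [Kf fmax] [Kg gmax]; split; first exact: fractional_midpoint.
  move=> h Kh; have bf := unit_mfun_bounded (K01 _ Kf).
  have bg := unit_mfun_bounded (K01 _ Kg).
  have -> : \int[mu]_z ((f z + g z) / 2) = 2^-1 * (\int[mu]_z f z + \int[mu]_z g
    z).
    rewrite -bounded_integralD// -bounded_integralZ; last exact: bounded_mfunD.
    by apply: eq_Rintegral => x _; rewrite mulrC.
  by have := fmax _ Kh; have := gmax _ Kh; lra.
- move=> u f C uK mC C0 uf.
  have uK' n : fractional (u n) by case: (uK n).
  split; first exact: fractional_ae_closed uK' mC C0 uf.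
  move=> g Kg; have cu := cvg_integralM_ae (fun n => K01 _ (uK' n)) b1 mC C0 uf.
  rewrite (mul1 f) -(cvg_lim _ cu)//; apply: limr_ge.
    by apply/cvg_ex; eexists; exact: cu.
  by apply: nearW => n; have [_ ] := uK n; rewrite -mul1; exact.
Qed.

(** Otherwise f + M^-1 h, for h the perturbation built from f (1 - f) and M a
    bound on h / (f (1 - f)), would be a better choice: its values stay in
    [0, 1], its marginals are those of f, and its integral against p q is
    larger. *)
Lemma extremal_fractional_01 (f : S * T -> R) (p : S -> R) (q : T -> R) :
  bounded_mfun p -> bounded_mfun q ->
  prod_measure nu nu [set z | p z.1 = p z.2] = 0%E ->
  prod_measure eta eta [set z | q z.1 = q z.2] = 0%E ->
  optimal_fractional f ->
  (forall g, optimal_fractional g ->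
    \int[mu]_z (g z * (p z.1 * q z.2)) <= \int[mu]_z (f z * (p z.1 * q z.2))) ->
  {ae mu, forall z, f z * (1 - f z) = 0}.
Proof.
move=> bp bq pdiag qdiag [[uf fE fb fc] fopt] fmax.
have bf := unit_mfun_bounded uf; have [_ f01] := uf.
pose a z := f z * (1 - f z).
have ba : bounded_mfun a.
  by apply: bounded_mfunM => //; apply: bounded_mfunB => //;
    exact: bounded_mfun_cst.
have a0 z : 0 <= a z by have /andP[? ?] := f01 z; rewrite mulr_ge0// subr_ge0.
apply: integral0_ae => //.
have [g [bg gs gt gpos]] := marginal_free_perturbation ba a0 bp bq pdiag qdiag.
have [_ [M0 gM0]] := bg.
apply: contrapT => /eqP ia0.
have {}gpos := gpos _; have {}gpos : 0 < \int[mu]_z (a z * g z * (p z.1 * q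
  z.2)).
  by apply: gpos; rewrite lt_neqAle eq_sym ia0 Rintegral_ge0.
pose M := `|M0| + 1; have M_gt0 : 0 < M by rewrite ltr_wpDl.
have gM z : `|M^-1 * g z| <= 1.
  rewrite normrM gtr0_norm ?invr_gt0// mulrC ler_pdivrMr// mul1r.
  by apply: le_trans (gM0 z) _; apply: le_trans (ler_norm _) _; rewrite lerDl.
have bag : bounded_mfun (fun z => a z * g z) by exact: bounded_mfunM.
have bMag : bounded_mfun (fun z => M^-1 * (a z * g z)).
  by apply: bounded_mfunM => //; exact: bounded_mfun_cst.
pose h z := f z + M^-1 * (a z * g z).
have bh : bounded_mfun h by exact: bounded_mfunD.
have int_h d (X : measurableType d) (m : {finite_measure set X -> \bar R})
    (u v : X -> R) : bounded_mfun u -> bounded_mfun v -> \int[m]_x v x = 0 ->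
    \int[m]_x (u x + M^-1 * v x) = \int[m]_x u x.
  move=> bu bv v0; rewrite bounded_integralD//.
    by rewrite bounded_integralZ// v0 mulr0 addr0.
  by apply: bounded_mfunM => //; exact: bounded_mfun_cst.
have Kh : fractional h.
  split.
  - split; first by case: bh.
    move=> z; have /andP[f0 f1] := f01 z; have := gM z;
      rewrite ler_norml => /andP[g0 g1].
    rewrite /h /a; set r := M^-1 * g z in g0 g1.
    have -> : M^-1 * (f z * (1 - f z) * g z) = f z * (1 - f z) * r
      by rewrite /r; ring.
    apply/andP; split.
      have -> : f z + f z * (1 - f z) * r = f z * (f z + (1 - f z) * (1 + r))
        by ring.
      by rewrite mulr_ge0// addr_ge0// mulr_ge0// ?subr_ge0// -lerBlDl sub0r.
    rewrite -subr_ge0.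
    have -> : 1 - (f z + f z * (1 - f z) * r) =
        (1 - f z) * ((1 - f z) + f z * (1 - r)) by ring.
    by rewrite mulr_ge0 ?subr_ge0// addr_ge0 ?subr_ge0// mulr_ge0// subr_ge0.
  - by move=> z nEz; rewrite /h /a fE// !mul0r mulr0 addr0.
  - move=> t; rewrite (int_h _ _ nu (fun s => f (s, t)) (fun s =>
    a (s, t) * g (s, t)))//.
      exact: bounded_mfun_yslice.
    exact: (bounded_mfun_yslice t bag).
  - move=> s; rewrite (int_h _ _ eta (fun t => f (s, t)) (fun t =>
    a (s, t) * g (s, t)))//.
      exact: bounded_mfun_xslice.
    exact: (bounded_mfun_xslice s bag).
have hopt : optimal_fractional h.
  split=> // k Kk; rewrite (int_h _ _ mu f (fun z => a z * g z))//;
    first exact: fopt.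
  rewrite integral_prod12//.
  transitivity (\int[nu]_s (0 : R)); last by rewrite Rintegral_cst// mul0r.
  by apply: eq_Rintegral => s _; exact: gt.
have bpq : bounded_mfun (fun z : S * T => p z.1 * q z.2).
  by apply: bounded_mfunM;
    [apply: (bounded_mfun_comp _ bp)|apply: (bounded_mfun_comp _ bq)];
    measurable_projection.
have := fmax _ hopt; apply/negP; rewrite -ltNge.
have -> : \int[mu]_z (h z * (p z.1 * q z.2)) =
    \int[mu]_z (f z * (p z.1 * q z.2)) +
    M^-1 * \int[mu]_z (a z * g z * (p z.1 * q z.2)).
  rewrite -bounded_integralZ; last exact: bounded_mfunM.
  rewrite -bounded_integralD; last 2 first.
  - exact: bounded_mfunM.
  - by apply: bounded_mfunM; [exact: bounded_mfun_cst|exact: bounded_mfunM].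
  by apply: eq_Rintegral => z _; rewrite /h; ring.
by rewrite ltrDl mulr_gt0// invr_gt0.
Qed.

End fractional.

(** * Rounding *)

Section indicator_sections.
Context d1 d2 (S : measurableType d1) (T : measurableType d2) (R : realType).
Variables (nu : {finite_measure set S -> \bar R})
          (eta : {finite_measure set T -> \bar R}).
Variable F : set (S * T).
Hypothesis mF : measurable F.

Lemma integral_indic_ysection t :
  (\int[nu]_s (\1_F (s, t) : R))%:E = nu (ysection F t).
Proof.
rewrite EFin_bounded_integral.
  rewrite -(setIT (ysection F t)) -integral_indic//;
    last exact: measurable_ysection.
  by apply: eq_integral => s _; rewrite !indicE mem_ysection.
exact: (bounded_mfun_yslice t (bounded_mfun_indic R mF)).
Qed.

Lemma integral_indic_xsection s :
  (\int[eta]_t (\1_F (s, t) : R))%:E = eta (xsection F s).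
Proof.
rewrite EFin_bounded_integral.
  rewrite -(setIT (xsection F s)) -integral_indic//;
    last exact: measurable_xsection.
  by apply: eq_integral => t _; rewrite !indicE mem_xsection.
exact: (bounded_mfun_xslice s (bounded_mfun_indic R mF)).
Qed.

Lemma integral_indic_prod :
  (\int[prod_measure nu eta]_z (\1_F z : R))%:E = (nu \x eta)%E F.
Proof.
rewrite EFin_bounded_integral; last exact: bounded_mfun_indic.
by rewrite integral_indic// setIT.
Qed.

End indicator_sections.

Section rounding.
Context d1 d2 (S : measurableType d1) (T : measurableType d2) (R : realType).
Variables (nu : {finite_measure set S -> \bar R})
          (eta : {finite_measure set T -> \bar R}).
Variables (E : set (S * T)) (b : T -> R) (c : S -> R).
Hypotheses (b0 : forall t, 0 <= b t) (c0 : forall s, 0 <= c s).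
Local Notation mu := (prod_measure nu eta).

(** The section constraints of a feasible set may fail on null sets of s and t;
    removing these rows and columns leaves the product measure unchanged. *)
Lemma feasible_fractional (F : set (S * T)) : feasible nu eta E b c F ->
  exists2 f, fractional nu eta E b c f & (nu \x eta)%E F = (\int[mu]_z f z)%:E.
Proof.
move=> [mF FE [N1 [mN1 N10 bN1]] [N2 [mN2 N20 cN2]]].
have mN : measurable (~` N2 `*` ~` N1) by apply: measurableX;
  exact: measurableC.
pose F' := F `&` (~` N2 `*` ~` N1).
have mF' : measurable F' by exact: measurableI.
exists (\1_F'); first split.
- split; first exact: measurable_indic.
  by move=> z; rewrite indicE; case: (_ \in _); rewrite ?lexx ?ler01.
- by move=> z nEz; rewrite indicE memNset// => -[/FE].
- move=> t; rewrite -lee_fin integral_indic_ysection//.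
  have [tN1|tN1] := pselect (N1 t).
    rewrite (_ : ysection F' t = set0) ?measure0 ?lee_fin//.
    by apply/seteqP; split=> // s; rewrite /ysection/= inE => -[_ [_ /(_ tN1)]].
  have bt : (nu (ysection F t) <= (b t)%:E)%E by apply: contrapT => h;
    apply: tN1; exact: bN1.
  apply: le_trans bt; apply: le_measure; rewrite ?inE//;
    try exact: measurable_ysection.
  by move=> s; rewrite /ysection/= !inE => -[].
- move=> s; rewrite -lee_fin integral_indic_xsection//.
  have [sN2|sN2] := pselect (N2 s).
    rewrite (_ : xsection F' s = set0) ?measure0 ?lee_fin//.
    by apply/seteqP; split=> // t; rewrite /xsection/= inE => -[_ [/(_ sN2)]].
  have cs : (eta (xsection F s) <= (c s)%:E)%E by apply: contrapT => h;
    apply: sN2; exact: cN2.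
  apply: le_trans cs; apply: le_measure; rewrite ?inE//;
    try exact: measurable_xsection.
  by move=> t; rewrite /xsection/= !inE => -[].
rewrite integral_indic_prod//
  -(integral_indic_prod nu eta mF) -(integral_indic_prod nu eta mF').
congr EFin; apply: ae_eq_Rintegral; try exact: bounded_mfun_indic.
exists ((setT `*` N1) `|` (N2 `*` setT)); split.
- by apply: measurableU; exact: measurableX.
- have SN1 : prod_measure nu eta (setT `*` N1) = 0%E.
    by transitivity (nu setT * eta N1)%E;
      [exact: product_measure1E|rewrite N10 mule0].
  have N2T : prod_measure nu eta (N2 `*` setT) = 0%E.
    by transitivity (nu N2 * eta setT)%E;
      [exact: product_measure1E|rewrite N20 mul0e].
  by apply: null_set_setU => //; exact: measurableX.
- move=> [s t] /= h; apply: contrapT => /not_orP[/= h1 h2]; apply: h.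
  rewrite !indicE; congr (nat_of_bool _)%:R; apply/idP/idP => /set_mem;
    rewrite inE.
    by move=> Fst; split=> //; split=> ?; [apply: h2|apply: h1].
  by case.
Qed.

(** The indicator of [set z | f z = 1] lies below f, so it inherits the section
    constraints, and equals f almost everywhere. *)
Lemma rounding (f : S * T -> R) : fractional nu eta E b c f ->
  {ae mu, forall z, f z * (1 - f z) = 0} ->
  exists2 F, feasible nu eta E b c F & (nu \x eta)%E F = (\int[mu]_z f z)%:E.
Proof.
move=> [uf fE fb fc] f01; have bf := unit_mfun_bounded uf; have [mf f_01] := uf.
pose F := [set z | f z = 1].
have mF : measurable F by apply: measurable_eq_fun => //; exact: measurable_cst.
have bF : bounded_mfun (\1_F : S * T -> R) by exact: bounded_mfun_indic.
have Ff z : \1_F z <= f z.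
  rewrite indicE; have [/set_mem ->//|_] := boolP (z \in F).
  by case/andP: (f_01 z).
exists F; first split=> //.
- move=> z /= fz1; apply: contrapT => /fE; rewrite fz1; apply/eqP;
  exact: oner_neq0.
- apply: aeW => t; rewrite -integral_indic_ysection// lee_fin.
  apply: le_trans (fb t); apply: bounded_le_integral => //;
    exact: bounded_mfun_yslice.
- apply: aeW => s; rewrite -integral_indic_xsection// lee_fin.
  apply: le_trans (fc s); apply: bounded_le_integral => //;
    exact: bounded_mfun_xslice.
rewrite -(integral_indic_prod nu eta mF); congr EFin;
  apply: ae_eq_Rintegral => //.
apply: filterS f01 => z /eqP;
  rewrite mulf_eq0 subr_eq0 indicE => /orP[/eqP fz0|/eqP fz1].
  by rewrite fz0 memNset//= /F/= fz0 => /esym/eqP; rewrite oner_eq0.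
by rewrite mem_set// /F/= -fz1.
Qed.

End rounding.

Unset Implicit Arguments.
Set Printing Implicit Defensive.

Theorem theorem7p11 (R : realType) (d1 d2 : measure_display)
    (S : measurableType d1) (T : measurableType d2)
    (nu : {finite_measure set S -> \bar R})
    (eta : {finite_measure set T -> \bar R})
    (hS : standard_measure_space nu) (hT : standard_measure_space eta)
    (b : T -> R) (c : S -> R)
    (mb : measurable_fun [set: T] b) (mc : measurable_fun [set: S] c)
    (hb : forall t : T, (0 <= (b t)%:E <= nu [set: S])%E)
    (hc : forall s : S, (0 <= (c s)%:E <= eta [set: T])%E)
    (E : set (S * T)) (mE : measurable E) :
  exists2 F : set (S * T),
    feasible nu eta E b c F & (nu \x eta)%E F = max_measure nu eta E b c.
Proof.
have b0 t : 0 <= b t by have /andP[] := hb t; rewrite lee_fin.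
have c0 s : 0 <= c s by have /andP[] := hc s; rewrite lee_fin.
have [p [bp pinj]] := standard_borel_code hS.1.
have [q [bq qinj]] := standard_borel_code hT.1.
have pdiag := atomless_diagonal hS.2 bp.1 pinj.
have qdiag := atomless_diagonal hT.2 bq.1 qinj.
have bpq : bounded_mfun (fun z : S * T => p z.1 * q z.2).
  by apply: bounded_mfunM;
    [apply: (bounded_mfun_comp _ bp)|apply: (bounded_mfun_comp _ bq)];
    measurable_projection.
have [f fopt fmax] := optimal_fractional_maximizer nu eta E b0 c0 bpq.
have f01 := extremal_fractional_01 bp bq pdiag qdiag fopt fmax.
have [F feasF muF] := rounding fopt.1 f01.
exists F => //; apply/eqP; rewrite eq_le; apply/andP; split.
  by apply: ereal_sup_ubound; exists F.
apply: ge_ereal_sup => _ [G feasG <-].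
have [g Kg ->] := feasible_fractional b0 c0 feasG.
by rewrite muF lee_fin; exact: fopt.2.
Qed.
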